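(* Let $n \geq 1$, $u \in \mathfrak{P}_n$, $v$ a packed word of length $m \geq 1$, and $i \in [n]$. Then, in $\mathsf{PAs}^{\rightarrow}$, $$\mathsf{E}_u \circ_i \mathsf{E}_v = \left(\mathsf{E}_{\chi(u)} \circ_{\mathrm{rec}_i(u)} \mathsf{E}_{\chi(v)}\right) \cdot B_i(\mathrm{st}(u), \mathrm{st}(v)),$$ where the partial composition $\circ_{\mathrm{rec}_i(u)}$ on the right-hand side is that of the interstice operad $\mathsf{I}_2$ (via the identification of weakly increasing packed words with words over $\{1,2\}$ described below). In particular, $\chi(\mathsf{E}_u \circ_i \mathsf{E}_v) = \mathsf{E}_{\chi(u)} \circ_{\mathrm{rec}_i(u)} \mathsf{E}_{\chi(v)}$ and $\mathrm{st}(\mathsf{E}_u \circ_i \mathsf{E}_v) = \mathsf{E}_{B_i(\mathrm{st}(u),\mathrm{st}(v))}$.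
   Context: Notation: $\mathbb{P}=\{1,2,\dots\}$, $[i]=\{1,\dots,i\}$; for a word $w$, $w(i)$ is its $i$-th letter, $w(i,j)=w(i)\cdots w(j)$ (empty if $j<i$), $.$ is concatenation. A packed word is a word over $\mathbb{P}$ whose set of letters is $[k]$ for some $k$; $\mathfrak{P}_n$ is the set of packed words of length $n$; $\mathfrak{S}_n \subseteq \mathfrak{P}_n$ is the set of permutations of $[n]$ (written as words). $\mathrm{inc}_{\alpha,\beta}(u)$ adds $\alpha$ to each letter of $u$ strictly greater than $\beta$. The operad $\mathsf{PAs}^{\rightarrow}$: $\mathsf{PAs}^{\rightarrow}(n)$ has basis $\{\mathsf{E}_u : u \in \mathfrak{P}_n\}$, and for $u\in\mathfrak{P}_n$, $i\in[n]$, $v \in \mathfrak{P}_m$ with maximal letter $s$: $\mathsf{E}_u \circ_i \mathsf{E}_v = \mathsf{E}_{\mathrm{inc}_{s-1,u(i)}(u(1,i-1)) . \mathrm{inc}_{u(i)-1,0}(v) . \mathrm{inc}_{s-1,u(i)-1}(u(i+1,n))}$. Standardization: $\mathrm{st}(w) \in \mathfrak{S}_n$ for a word $w$ of length $n$ is obtained by scanning $w$ left to right and labelling $1,2,\dots$ the occurrences of its smallest letter, then continuing with the occurrences of the next smallest letter, and so on. For $u \in \mathfrak{P}_n$ and $i\in[n]$, $\mathrm{rec}_i(u) := \mathrm{st}(u)(i)$. $\chi(w)$ is the weakly increasing rearrangement of $w$. The maps $\chi$, $\mathrm{st}$ are extended linearly via $\mathsf{E}_w \mapsto \mathsf{E}_{\chi(w)}$,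 $\mathsf{E}_w \mapsto \mathsf{E}_{\mathrm{st}(w)}$. Right action: for $w \in \mathfrak{P}_n$ and $\sigma \in \mathfrak{S}_n$, $\mathsf{E}_w \cdot \sigma = \mathsf{E}_{w(\sigma(1))\cdots w(\sigma(n))}$, extended linearly. Block permutation: for $\alpha \in \mathfrak{S}_n$, $\beta \in \mathfrak{S}_m$, $i \in [n]$, $B_i(\alpha,\beta) := \mathrm{inc}_{m-1,\alpha(i)}(\alpha(1,i-1)) . \mathrm{inc}_{\alpha(i)-1,0}(\beta) . \mathrm{inc}_{m-1,\alpha(i)-1}(\alpha(i+1,n)) \in \mathfrak{S}_{n+m-1}$. Interstice operad $\mathsf{I}_2$: a weakly increasing packed word $w$ of length $n$ is identified with the word $x \in \{1,2\}^{n-1}$ where $x(j)=2$ if $w(j+1)>w(j)$ and $x(j)=1$ if $w(j+1)=w(j)$ (e.g. $1122233 \leftrightarrow 121121$); such an $x$ has arity $n$. The partial composition of $\mathsf{I}_2$ is $\mathsf{E}_x \circ_j \mathsf{E}_y = \mathsf{E}_{x(1,j-1) . y . x(j,\ell(x))}$, $\ell(x)$ being the length of $x$. Example: $u=2311223$, $v=221$, $i=5$: $\mathrm{rec}_5(u)=4$, the right side is $\mathsf{E}_{112233344}\cdot 381256479 = \mathsf{E}_{241133234}=\mathsf{E}_u\circ_5\mathsf{E}_v$. *)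

(* Defs.v *)
(* Words are sequences of naturals; [letter] and [subword] use 1-based positions. *)
From HB Require Import structures.
From mathcomp Require Import all_boot all_order all_algebra.
From mathcomp Require Import zify.
From mathcomp Require Import finmap.
From mathcomp.multinomials Require Import monalg.

Set Implicit Arguments.
Unset Strict Implicit.
Unset Printing Implicit Defensive.

Import GRing.Theory.

Definition letter (w : seq nat) (i : nat) : nat := nth 0 w i.-1.

Definition subword (w : seq nat) (i j : nat) : seq nat :=
  take (j.+1 - i) (drop i.-1 w).

Definition maxletter (w : seq nat) : nat := \max_(a <- w) a.

Definition inc (alpha beta : nat) (u : seq nat) : seq nat :=
  [seq if beta < a then a + alpha else a | a <- u].

(* The word shared by the composition of packed words (s = maximal letter of v)
   and by block permutations (s = length of v). *)
Definition insert_word (s : nat) (u : seq nat) (i : nat) (v : seq nat) :=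
  inc s.-1 (letter u i) (subword u 1 i.-1)
    ++ inc (letter u i).-1 0 v
    ++ inc s.-1 (letter u i).-1 (subword u i.+1 (size u)).

(* The positions of w in the order in which standardization labels them:
   letters by increasing value, occurrences of a letter from left to right. *)
Definition label_order (w : seq nat) : seq nat :=
  flatten [seq [seq j <- iota 1 (size w) | letter w j == a]
          | a <- sort leq (undup w)].

Definition st_word (w : seq nat) : seq nat :=
  [seq (index j (label_order w)).+1 | j <- iota 1 (size w)].

Definition chi_word (w : seq nat) : seq nat := sort leq w.

Definition act_word (w sigma : seq nat) : seq nat :=
  [seq letter w s | s <- sigma].

Definition has_letters (w : seq nat) (k : nat) :=
  forall a, (a \in w) = (1 <= a <= k).

Definition is_packed (w : seq nat) : bool :=
  (0 \notin w) && all (mem w) (iota 1 (maxletter w)).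

Lemma maxletter_ge w a : a \in w -> a <= maxletter w.
Proof. by move=> aw; rewrite /maxletter; apply: leq_bigmax_seq. Qed.

Lemma has_letters_max w k : has_letters w k -> maxletter w = k.
Proof.
move=> hw; apply/eqP; rewrite eqn_leq; apply/andP; split.
  by apply/bigmax_leqP_seq => a; rewrite hw => /andP[].
case: k hw => // k hw; apply: maxletter_ge; rewrite hw; lia.
Qed.

Lemma is_packedP w : reflect (exists k, has_letters w k) (is_packed w).
Proof.
apply: (iffP andP) => [[w0 /allP wk]|[k hw]].
  exists (maxletter w) => a; apply/idP/idP => [aw|ha].
    by rewrite maxletter_ge // andbT lt0n; apply: contraNneq w0 => <-.
  by apply: wk; rewrite mem_iota; lia.
split; first by rewrite hw.
rewrite (has_letters_max hw); apply/allP => a; rewrite mem_iota /= hw; lia.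
Qed.

Lemma has_letters_maxletter w : is_packed w -> has_letters w (maxletter w).
Proof. by case/is_packedP => k hw; rewrite (has_letters_max hw). Qed.

Lemma mem_inc alpha beta u b :
  (b \in inc alpha beta u) =
  ((b <= beta) && (b \in u)) ||
  [&& beta < b - alpha, alpha <= b & b - alpha \in u].
Proof.
apply/mapP/orP => [[a au ->]|].
  case: ifP => h; [right|left]; last by rewrite au andbT leqNgt h.
  by rewrite addnK h leq_addl.
case=> [/andP[h bu]|/and3P[h1 h2 bu]].
  by exists b => //; rewrite ltnNge h.
by exists (b - alpha) => //; rewrite h1 subnK.
Qed.

Lemma subword_split u i : i < size u ->
  u = subword u 1 i ++ letter u i.+1 :: subword u i.+2 (size u).
Proof.
move=> hi; rewrite /subword /letter /= subn1 /= drop0 -{1}(cat_take_drop i u).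
rewrite (drop_nth 0) //; congr (_ ++ _ :: _).
by rewrite take_oversize // size_drop; lia.
Qed.

Lemma size_insert_word s u i v : i < size u ->
  size (insert_word s u i.+1 v) = (size u + size v).-1.
Proof.
move=> hi; rewrite /insert_word !size_cat !size_map.
have := congr1 size (subword_split hi); rewrite size_cat /=; lia.
Qed.

Lemma has_letters_insert k s u v i : i < size u ->
  has_letters u k -> has_letters v s -> 0 < size v ->
  has_letters (insert_word s u i.+1 v) (k + s.-1).
Proof.
move=> hi hu hv v0 b.
have s0 : 0 < s.
  by case: v hv v0 => // a v hv _; have := hv a; rewrite mem_head; lia.
have hc : 1 <= letter u i.+1 <= k by rewrite -hu /letter mem_nth.
set c := letter u i.+1 in hc *.
have hsplit a : (1 <= a <= k) =
  [|| a \in subword u 1 i, a == c | a \in subword u i.+2 (size u)].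
  by rewrite -hu {1}(subword_split hi) mem_cat inE.
rewrite /insert_word -/c !mem_cat !mem_inc !hv /=.
have := hsplit b; have := hsplit (b - s.-1).
case: (b \in subword u 1 i); case: (b \in subword u _ _);
case: (b - s.-1 \in subword u 1 i); case: (b - s.-1 \in subword u _ _);
rewrite ?orbT ?orbF /=; lia.
Qed.

Lemma perm_eq_has_letters n w : size w = n ->
  has_letters w n -> perm_eq w (iota 1 n).
Proof.
move=> sw hw; have hmem : w =i iota 1 n by move=> a; rewrite hw mem_iota add1n ltnS.
apply: uniq_perm; rewrite ?iota_uniq //.
by rewrite (uniq_size_uniq (iota_uniq 1 n) (fun a => esym (hmem a))) sw size_iota.
Qed.

Lemma has_letters_perm n w : perm_eq w (iota 1 n) -> has_letters w n.
Proof. by move=> /perm_mem hw a; rewrite hw mem_iota add1n ltnS. Qed.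

Lemma packed_perm n w : perm_eq w (iota 1 n) -> is_packed w.
Proof. by move=> hw; apply/is_packedP; exists n; apply: has_letters_perm. Qed.

Lemma mem_label_order w j : (j \in label_order w) = (1 <= j <= size w).
Proof.
apply/flatten_mapP/idP => [[a _]|hj].
  by rewrite mem_filter mem_iota add1n ltnS => /andP[].
exists (letter w j); last by rewrite mem_filter eqxx mem_iota /=; lia.
by rewrite mem_sort mem_undup /letter mem_nth //; case: j hj.
Qed.

Lemma label_order_uniq w : uniq (label_order w).
Proof.
rewrite /label_order; have : uniq (sort leq (undup w)).
  by rewrite sort_uniq undup_uniq.
elim: (sort _ _) => //= a t IH /andP[at_ ut].
rewrite cat_uniq filter_uniq ?iota_uniq // IH // andbT /=.
apply/hasPn => j /flatten_mapP[b bt]; rewrite mem_filter => /andP[/eqP jb _].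
rewrite /= mem_filter jb; apply: contra at_ => /andP[/eqP <- _]; exact: bt.
Qed.

Lemma size_label_order w : size (label_order w) = size w.
Proof.
rewrite -(size_iota 1 (size w)); apply/perm_size/uniq_perm.
- exact: label_order_uniq.
- exact: iota_uniq.
- by move=> j; rewrite mem_label_order mem_iota; lia.
Qed.

Lemma st_word_perm w : perm_eq (st_word w) (iota 1 (size w)).
Proof.
have hsz : size (st_word w) = size w by rewrite size_map size_iota.
have hu : uniq (st_word w).
  rewrite map_inj_in_uniq ?iota_uniq // => x y; rewrite !mem_iota => hx hy [].
  by apply: (index_inj 0); rewrite mem_label_order -ltnS -add1n.
apply: uniq_perm; rewrite ?iota_uniq //.
have hsub : {subset st_word w <= iota 1 (size w)}.
  move=> a /mapP[j]; rewrite !mem_iota => hj ->.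
  have := index_mem j (label_order w).
  by rewrite mem_label_order size_label_order; lia.
by have [] := uniq_min_size hu hsub; rewrite // hsz size_iota.
Qed.

Record packed (n : nat) := Packed {
  packed_word :> n.-tuple nat;
  packedP : is_packed packed_word }.

HB.instance Definition _ n := [isSub for @packed_word n].
HB.instance Definition _ n := [Choice of packed n by <:].

Record wipacked (n : nat) := Wipacked {
  wipacked_packed :> packed n;
  wipackedP : sorted leq wipacked_packed }.

HB.instance Definition _ n := [isSub for @wipacked_packed n].
HB.instance Definition _ n := [Choice of wipacked n by <:].

Record permword (n : nat) := Permword {
  permword_packed :> packed n;
  permwordP : perm_eq permword_packed (iota 1 n) }.

HB.instance Definition _ n := [isSub for @permword_packed n].
HB.instance Definition _ n := [Choice of permword n by <:].

(* Words over {1, 2} of arity n, hence of length n - 1. *)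
Record i2word (n : nat) := I2word {
  i2word_word :> n.-1.-tuple nat;
  i2wordP : all (mem [:: 1; 2]) i2word_word }.

HB.instance Definition _ n := [isSub for @i2word_word n].
HB.instance Definition _ n := [Choice of i2word n by <:].

Section Words.

Context {n m : nat}.

Lemma chi_proof0 (u : packed n) : size (chi_word u) == n.
Proof. by rewrite size_sort size_tuple. Qed.

Lemma chi_proof1 (u : packed n) : is_packed (Tuple (chi_proof0 u)).
Proof.
have /is_packedP[k hk] := packedP u; apply/is_packedP; exists k => a.
by rewrite /= mem_sort hk.
Qed.

Lemma chi_proof2 (u : packed n) : sorted leq (Packed (chi_proof1 u)).
Proof. exact: (sort_sorted leq_total). Qed.

Definition chi (u : packed n) : wipacked n := Wipacked (chi_proof2 u).

Lemma st_proof0 (u : packed n) : size (st_word u) == n.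
Proof. by rewrite size_map size_iota size_tuple. Qed.

Lemma st_proof2 (u : packed n) : perm_eq (st_word u) (iota 1 n).
Proof. by have := st_word_perm u; rewrite size_tuple. Qed.

Lemma st_proof1 (u : packed n) : is_packed (Tuple (st_proof0 u)).
Proof. exact: packed_perm (st_proof2 u). Qed.

Definition st (u : packed n) : permword n :=
  @Permword n (Packed (st_proof1 u)) (st_proof2 u).

Lemma act_proof0 (w : packed n) (sigma : permword n) :
  size (act_word w sigma) == n.
Proof. by rewrite size_map size_tuple. Qed.

Lemma act_proof1 (w : packed n) (sigma : permword n) :
  is_packed (Tuple (act_proof0 w sigma)).
Proof.
have /is_packedP[k hk] := packedP w; apply/is_packedP; exists k => a.
have hs := has_letters_perm (permwordP sigma).
rewrite -hk; apply/mapP/idP => [[s]|aw].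
  by rewrite hs => ? ->; rewrite /letter mem_nth // size_tuple; lia.
exists (index a w).+1; last by rewrite /letter /= nth_index.
by rewrite hs /= -[X in _ < X](size_tuple w) index_mem.
Qed.

Definition act (w : packed n) (sigma : permword n) : packed n :=
  Packed (act_proof1 w sigma).

End Words.

(* Here and below an ordinal i : 'I_n.+1 stands for the position i + 1
   of [n + 1]. All arities are positive, hence written as successors; note
   that (n + 1) + (m + 1) - 1 = (n + m) + 1. *)
Definition rec {n : nat} (i : 'I_n.+1) (u : packed n.+1) : 'I_n.+1 :=
  inord (letter (st u) i.+1).-1.

Lemma recE n (i : 'I_n.+1) (u : packed n.+1) :
  (rec i u).+1 = letter (st u) i.+1.
Proof.
have := has_letters_perm (permwordP (st u)) (letter (st u) i.+1).
rewrite {1}/letter mem_nth ?size_tuple ?ltn_ord // => /esym h.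
by rewrite /rec inordK; lia.
Qed.

Section Compositions.

Context {n m : nat}.

Lemma comp_proof0 (s : nat) (u : packed n.+1) (i : 'I_n.+1) (v : packed m.+1) :
  size (insert_word s u i.+1 v) == (n + m).+1.
Proof. by rewrite size_insert_word ?size_tuple // addSn addnS. Qed.

Lemma pas_proof1 (u : packed n.+1) (i : 'I_n.+1) (v : packed m.+1) :
  is_packed (Tuple (comp_proof0 (maxletter v) u i v)).
Proof.
apply/is_packedP; exists (maxletter u + (maxletter v).-1).
by apply: has_letters_insert;
  rewrite ?size_tuple //; apply/has_letters_maxletter/packedP.
Qed.

Definition pas_word (u : packed n.+1) (i : 'I_n.+1) (v : packed m.+1) :
  packed (n + m).+1 := Packed (pas_proof1 u i v).

Lemma block_proof2 (alpha : permword n.+1) (i : 'I_n.+1) (beta : permword m.+1) :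
  perm_eq (insert_word m.+1 alpha i.+1 beta) (iota 1 (n + m).+1).
Proof.
apply: perm_eq_has_letters; first by apply/eqP/comp_proof0.
rewrite -addSn; apply: has_letters_insert; rewrite ?size_tuple //;
  exact: has_letters_perm (permwordP _).
Qed.

Lemma block_proof1 (alpha : permword n.+1) (i : 'I_n.+1) (beta : permword m.+1) :
  is_packed (Tuple (comp_proof0 m.+1 alpha i beta)).
Proof. exact: packed_perm (block_proof2 alpha i beta). Qed.

Definition block (i : 'I_n.+1) (alpha : permword n.+1) (beta : permword m.+1) :
  permword (n + m).+1 :=
  @Permword _ (Packed (block_proof1 alpha i beta)) (block_proof2 alpha i beta).

Lemma i2_proof0 (x : i2word n.+1) (j : 'I_n.+1) (y : i2word m.+1) :
  size (subword x 1 j ++ y ++ subword x j.+1 (size x)) == (n + m).+1.-1.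
Proof.
rewrite /subword /= subn1 /= drop0 !size_cat !size_take !size_drop !size_tuple /=.
by have := ltn_ord j; case: ifP; case: ifP; lia.
Qed.

Lemma i2_proof1 (x : i2word n.+1) (j : 'I_n.+1) (y : i2word m.+1) :
  all (mem [:: 1; 2]) (Tuple (i2_proof0 x j y)).
Proof.
rewrite /= !all_cat (i2wordP y) /=; apply/andP.
by split; apply/allP => a /mem_take /mem_drop; apply/allP/i2wordP.
Qed.

Definition i2_word (x : i2word n.+1) (j : 'I_n.+1) (y : i2word m.+1) :
  i2word (n + m).+1 := I2word (i2_proof1 x j y).

End Compositions.

(* The identification of weakly increasing packed words with words over {1, 2}. *)
Definition to_i2_word (w : seq nat) : seq nat :=
  [seq if letter w j < letter w j.+1 then 2 else 1 | j <- iota 1 (size w).-1].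

Definition of_i2_word (x : seq nat) : seq nat :=
  1 :: scanl (fun a b => a + b.-1) 1 x.

Section Identification.

Context {n : nat}.

Lemma to_i2_proof0 (w : wipacked n) : size (to_i2_word w) == n.-1.
Proof. by rewrite size_map size_iota size_tuple. Qed.

Lemma to_i2_proof1 (w : wipacked n) :
  all (mem [:: 1; 2]) (Tuple (to_i2_proof0 w)).
Proof. by apply/allP => a /mapP[j _ ->]; case: ifP. Qed.

Definition to_i2 (w : wipacked n) : i2word n := I2word (to_i2_proof1 w).

Lemma of_i2_proof0 (x : i2word n.+1) : size (of_i2_word x) == n.+1.
Proof. by rewrite /= size_scanl size_tuple. Qed.

Lemma of_i2_path a (x : seq nat) : path leq a (scanl (fun a b => a + b.-1) a x).
Proof. by elim: x a => //= b x IH a; rewrite leq_addr IH. Qed.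

Lemma of_i2_letters c (x : seq nat) : all (mem [:: 1; 2]) x -> exists k,
  c <= k /\ forall a,
    (a \in c :: scanl (fun a b => a + b.-1) c x) = (c <= a <= k).
Proof.
elim: x c => [|b x IH] c /=.
  by move=> _; exists c; split => // a; rewrite inE; lia.
case/andP => hb /(IH (c + b.-1))[k [hk hx]]; exists k; split; first by lia.
by move=> a; rewrite inE hx; move: hb; rewrite !inE => /orP[] /eqP ->; lia.
Qed.

Lemma of_i2_proof1 (x : i2word n.+1) : is_packed (Tuple (of_i2_proof0 x)).
Proof.
have [k [_ hk]] := of_i2_letters 1 (i2wordP x).
by apply/is_packedP; exists k.
Qed.

Lemma of_i2_proof2 (x : i2word n.+1) : sorted leq (Packed (of_i2_proof1 x)).
Proof. exact: of_i2_path. Qed.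

Definition of_i2 (x : i2word n.+1) : wipacked n.+1 := Wipacked (of_i2_proof2 x).

Lemma to_i2_word_cons c d w :
  to_i2_word (c :: d :: w) = (if c < d then 2 else 1) :: to_i2_word (d :: w).
Proof.
rewrite /to_i2_word /=; congr (_ :: _); rewrite (iotaDl 1 1) -map_comp.
by apply/eq_in_map => -[|j]; rewrite mem_iota.
Qed.

End Identification.

Lemma of_i2K n : cancel (@of_i2 n) to_i2.
Proof.
move=> x; apply/val_inj/val_inj => /=.
have := i2wordP x; rewrite /of_i2_word; move: (val (val x)) => {x} x.
move=> hx; move: 1 => c; elim: x c hx => // b x IH c /andP[hb hx].
rewrite [scanl _ _ _]/= to_i2_word_cons IH //; congr (_ :: _).
by move: hb; rewrite !inE => /orP[] /eqP ->; case: ifP; lia.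
Qed.

Lemma scanl_to_i2 c w : path leq c w ->
  (forall a b, c <= a -> a <= b -> b \in c :: w -> a \in c :: w) ->
  scanl (fun a b => a + b.-1) c (to_i2_word (c :: w)) = w.
Proof.
elim: w c => // d w IH c /andP[cd pd] hw.
have dmin a : a \in d :: w -> d <= a.
  by move: a; apply/allP; rewrite /= leqnn; exact: order_path_min leq_trans pd.
have hd : d = c + (if c < d then 2 else 1).-1.
  case: ifP => hcd; last by lia.
  have := hw c.+1 d (leqnSn c) hcd; rewrite !inE eqxx orbT -in_cons => /(_ isT).
  by case/orP => [/eqP|/dmin]; lia.
rewrite to_i2_word_cons /= -hd IH // => a b da ab bw.
have := hw a b (leq_trans cd da) ab.
rewrite inE bw orbT => /(_ isT); rewrite inE => /orP[/eqP ac|//].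
have -> : a = d by lia.
exact: mem_head.
Qed.

Lemma to_i2K n : cancel (@to_i2 n.+1) (@of_i2 n).
Proof.
move=> w; apply/val_inj/val_inj/val_inj => /=; rewrite /of_i2_word.
have /is_packedP[k hk] := packedP w; have := wipackedP w; have := size_tuple w.
move: hk; case: (val (val (val w))) => // c t hk _ /= ht.
have hmin a : a \in c :: t -> c <= a.
  by move: a; apply/allP; rewrite /= leqnn; exact: order_path_min leq_trans ht.
have c1 : c = 1.
  have := hk c; rewrite mem_head => /esym h.
  have /hmin : 1 \in c :: t by rewrite hk; lia.
  by lia.
by subst c; congr (_ :: _); apply: scanl_to_i2 => // a b; rewrite !hk; lia.
Qed.

Local Open Scope ring_scope.

Section Linear.

Context {K : fieldType}.

Definition lin_ext {T : choiceType} {V : lmodType K} (f : T -> V)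
    (g : {malg K[T]}) : V := \sum_(k <- msupp g) g@_k *: f k.

Lemma lin_extEw (T : choiceType) (V : lmodType K) (f : T -> V)
    (d : {fset T}) (g : {malg K[T]}) :
  (msupp g `<=` d)%fset -> lin_ext f g = \sum_(k <- d) g@_k *: f k.
Proof.
move=> le; rewrite /lin_ext; apply: big_fset_incl => // k _ /mcoeff_outdom ->.
by rewrite scale0r.
Qed.

Lemma lin_ext_is_linear (T : choiceType) (V : lmodType K) (f : T -> V) :
  linear (lin_ext f).
Proof.
move=> c g h; pose d := (msupp g `|` msupp h)%fset.
rewrite (@lin_extEw _ _ _ d (c *: g + h)).
  rewrite (@lin_extEw _ _ _ d g) ?fsubsetUl // (@lin_extEw _ _ _ d h) ?fsubsetUr //.
  rewrite scaler_sumr -big_split /=; apply: eq_bigr => k _.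
  by rewrite mcoeffD mcoeffZ scalerDl scalerA.
by apply: fsubset_trans (msuppD_le _ _) _; apply: fsetSU; apply: msuppZ_le.
Qed.

Lemma lin_extU (T : choiceType) (V : lmodType K) (f : T -> V) (k : T) :
  lin_ext f << k >> = f k.
Proof. by rewrite /lin_ext msuppU oner_eq0 big_seq_fset1 mcoeffUU scale1r. Qed.

End Linear.

Definition pas (K : fieldType) (n : nat) := {malg K[packed n]}.
Definition i2 (K : fieldType) (n : nat) := {malg K[i2word n]}.

HB.instance Definition _ K n := GRing.Lmodule.on (pas K n).
HB.instance Definition _ K n := GRing.Lmodule.on (i2 K n).

Definition E (K : fieldType) {n : nat} (u : packed n) : pas K n := << u >>.
Definition E2 (K : fieldType) {n : nat} (x : i2word n) : i2 K n := << x >>.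

Section Operads.

Context {K : fieldType} {n m : nat}.

Definition pas_comp (i : 'I_n.+1) (f : pas K n.+1) (g : pas K m.+1) :
    pas K (n + m).+1 :=
  lin_ext (fun u => lin_ext (fun v => E K (pas_word u i v)) g) f.

Definition i2_comp (j : 'I_n.+1) (f : i2 K n.+1) (g : i2 K m.+1) :
    i2 K (n + m).+1 :=
  lin_ext (fun x => lin_ext (fun y => E2 K (i2_word x j y)) g) f.

Definition pas_act (f : pas K n) (sigma : permword n) : pas K n :=
  lin_ext (fun w => E K (act w sigma)) f.

Definition pas_chi (f : pas K n) : pas K n := lin_ext (fun w => E K (chi w)) f.

Definition pas_st (f : pas K n) : pas K n := lin_ext (fun w => E K (st w)) f.

Definition pas_of_i2 (f : i2 K n.+1) : pas K n.+1 :=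
  lin_ext (fun x => E K (of_i2 x)) f.

End Operads.

(* Main.v *)
(* The standardization of w is the unique permutation such that, for positions
   j < k, its letters satisfy st(j) < st(k) exactly when w(j) <= w(k); a case
   analysis shows that B_i(st u, st v) has this property for the composition w
   of u and v, hence st w = B_i(st u, st v). If c = u(i), then the sorting of u
   reads P c Q with P of length rec_i(u) - 1, and that of w reads P V' Q',
   where V' and Q' are translates of the sorting of v and of Q, with V'
   starting at c and ending at c + s - 1. The ascents of w are thus those of
   P c, of v and of c Q, which is the composition of the interstice operad.
   Finally w = chi(w) . st(w) for every word. *)
Require Import Defs.
From mathcomp Require Import all_boot all_order all_algebra.
From mathcomp Require Import zify.

Set Implicit Arguments.
Unset Strict Implicit.
Unset Printing Implicit Defensive.

(** * Labelling order of positions, and w = chi(w) . st(w) *)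

Lemma sorted_ltn_undup (w : seq nat) : pairwise ltn (sort leq (undup w)).
Proof.
rewrite -(sorted_pairwise ltn_trans) ltn_sorted_uniq_leq.
by rewrite sort_uniq undup_uniq (sort_sorted leq_total).
Qed.

Definition label_lt (w : seq nat) : rel nat :=
  fun j k => (letter w j < letter w k) || ((letter w j == letter w k) && (j < k)).

(** The blocks of [label_order] come by increasing letter, and each is a filtered [iota], hence
    increasing in position. *)
Lemma label_order_pairwise w : pairwise (label_lt w) (label_order w).
Proof.
rewrite /label_order; have := sorted_ltn_undup w.
elim: (sort _ _) => //= a s IH /andP[/allP las /IH {}IH].
rewrite pairwise_cat IH andbT; apply/andP; split.
  apply/allrelP => j k; rewrite mem_filter => /andP[/eqP ja _].
  case/flatten_mapP => b /las ab; rewrite mem_filter => /andP[/eqP kb _].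
  by rewrite /label_lt ja kb (ab : a < b).
have : pairwise ltn [seq j <- iota 1 (size w) | letter w j == a].
  by apply: pairwise_filter; rewrite -(sorted_pairwise ltn_trans) iota_ltn_sorted.
apply: (sub_in_pairwise (P := fun j => letter w j == a)); last first.
  exact: filter_all.
by move=> j k /eqP ja /eqP ka jk; rewrite /label_lt ja ka eqxx (jk : j < k) orbT.
Qed.

(** Since [label_lt] is asymmetric and distinct positions have distinct indices, the implication
    given by [label_order_pairwise] is an equivalence. *)
Lemma index_label_order w j k :
  0 < j <= size w -> 0 < k <= size w ->
  (index j (label_order w) < index k (label_order w)) = label_lt w j k.
Proof.
move=> hj hk; have /(pairwiseP 0) lo := label_order_pairwise w.
have nj : nth 0 (label_order w) (index j (label_order w)) = j.
  by rewrite nth_index ?mem_label_order.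
have nk : nth 0 (label_order w) (index k (label_order w)) = k.
  by rewrite nth_index ?mem_label_order.
have ij : index j (label_order w) \in gtn (size (label_order w)).
  by rewrite inE index_mem mem_label_order.
have ik : index k (label_order w) \in gtn (size (label_order w)).
  by rewrite inE index_mem mem_label_order.
case: ltngtP => h.
- by have := lo _ _ ij ik h; rewrite nj nk => ->.
- by have := lo _ _ ik ij h; rewrite nj nk /label_lt; lia.
- by move: nj; rewrite h nk /label_lt => ->; lia.
Qed.

Lemma map_letter w : [seq letter w j | j <- iota 1 (size w)] = w.
Proof.
apply: (@eq_from_nth _ 0); rewrite size_map size_iota // => j hj.
by rewrite (nth_map 0) ?size_iota // nth_iota.
Qed.

Lemma sort_label_order w : sort leq w = map (letter w) (label_order w).
Proof.
apply: (sorted_eq leq_trans anti_leq); first exact: sort_sorted leq_total _.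
  rewrite (sorted_pairwise leq_trans) pairwise_map.
  apply: sub_pairwise (label_order_pairwise w) => j k.
  by rewrite /label_lt /=; lia.
rewrite perm_sort -{1}(map_letter w); apply: perm_map; apply: uniq_perm.
- exact: iota_uniq.
- exact: label_order_uniq.
- by move=> j; rewrite mem_label_order mem_iota; lia.
Qed.

(** The label of j is its rank in [label_order], and sorting lists the letters along [label_order];
    so the sorted word read at that label returns the j-th letter. *)
Lemma act_chi_st w : act_word (chi_word w) (st_word w) = w.
Proof.
rewrite /act_word /st_word -map_comp -[RHS]map_letter.
apply/eq_in_map => j; rewrite mem_iota => hj /=.
have jl : j \in label_order w by rewrite mem_label_order; lia.
by rewrite /chi_word sort_label_order {1}/letter /= (nth_map 0) ?index_mem // nth_index.
Qed.

(** * Standardization characterized by comparisons of labels *)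

(* [p] and [q] are pairs (letter, label), with [p] standing to the left of [q]. *)
Definition st_rel : rel (nat * nat) := fun p q => (p.2 < q.2) == (p.1 <= q.1).

Lemma size_st_word w : size (st_word w) = size w.
Proof. by rewrite size_map size_iota. Qed.

(** Equal letters are labelled from left to right, which is why [st_rel] compares letters weakly. *)
Lemma st_word_rel w : pairwise st_rel (zip w (st_word w)).
Proof.
apply/(pairwiseP (0, 0)) => j k; rewrite !inE size_zip size_st_word minnn.
move=> hj hk jk; rewrite !nth_zip ?size_st_word // /st_rel /=.
rewrite !(nth_map 0) ?size_iota // !nth_iota // ltnS index_label_order; try lia.
by rewrite /label_lt /letter /= !add0n; lia.
Qed.

Lemma count_ltn_iota n a : 0 < a <= n.+1 -> count (gtn a) (iota 1 n) = a.-1.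
Proof.
move=> ha; rewrite -size_filter (eq_filter (a2 := fun b => b < 1 + a.-1)).
  by rewrite filter_iota_ltn ?size_iota //; lia.
by move=> b /=; lia.
Qed.

Lemma count_ltn_perm n s a : perm_eq s (iota 1 n) -> a \in s ->
  a = (count (gtn a) s).+1.
Proof.
move=> hs; rewrite (perm_mem hs) mem_iota => ha.
by rewrite (permP hs) count_ltn_iota; lia.
Qed.

(** The relation fixes how any two labels compare, and an entry of a permutation of 1, ..., n is one
    more than the number of smaller entries. *)
Lemma st_rel_inj w s t :
  perm_eq s (iota 1 (size w)) -> perm_eq t (iota 1 (size w)) ->
  pairwise st_rel (zip w s) -> pairwise st_rel (zip w t) -> s = t.
Proof.
move=> ps pt rs rt.
have ss := perm_size ps; have st := perm_size pt; rewrite size_iota in ss st.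
have us : uniq s by rewrite (perm_uniq ps) iota_uniq.
have ut : uniq t by rewrite (perm_uniq pt) iota_uniq.
have st_lt j k : j < k < size w ->
    (nth 0 s j < nth 0 s k) = (nth 0 t j < nth 0 t k).
  move=> /andP[jk kw]; have jw := ltn_trans jk kw.
  have /(pairwiseP (0, 0)) /(_ j k) := rs.
  have /(pairwiseP (0, 0)) /(_ j k) := rt.
  rewrite !inE !size_zip ss st minnn jw kw => /(_ isT isT jk) + /(_ isT isT jk).
  by rewrite !nth_zip // /st_rel /= => /eqP -> /eqP ->.
apply: (@eq_from_nth _ 0); rewrite ?ss // => j jw.
rewrite (count_ltn_perm ps (_ : nth 0 s j \in s)) ?mem_nth ?ss //.
rewrite (count_ltn_perm pt (_ : nth 0 t j \in t)) ?mem_nth ?st //.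
rewrite -{2}(mkseq_nth 0 s) -{2}(mkseq_nth 0 t) /mkseq !count_map ss st.
congr _.+1; apply: eq_in_count => k; rewrite mem_iota => /= kw.
case: (ltngtP j k) => [jk|kj|->]; last by rewrite !ltnn.
  (* Here [st_lt] gives the comparison opposite to the one counted; the two are complementary
     because the entries are distinct. *)
  have eqF (r : seq nat) : size r = size w -> uniq r ->
      (nth 0 r j == nth 0 r k) = false.
    by move=> sr ur; rewrite nth_uniq ?sr //; lia.
  have := eqF s ss us; have := eqF t st ut; have := st_lt j k; lia.
by rewrite st_lt //; lia.
Qed.

(** * Standardization of a composition *)

Lemma insert_word_cat s A c B v :
  insert_word s (A ++ c :: B) (size A).+1 v =
  inc s.-1 c A ++ inc c.-1 0 v ++ inc s.-1 c.-1 B.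
Proof.
rewrite /insert_word /letter /subword /= nth_cat ltnn subnn /= subn1 /=.
rewrite drop0 take_size_cat // -cat_rcons drop_size_cat ?size_rcons //.
by rewrite take_oversize // size_cat size_rcons; lia.
Qed.

Lemma zip_inc a b c d s t : size s = size t ->
  zip (inc a b s) (inc c d t) =
  [seq (if b < p.1 then p.1 + a else p.1, if d < p.2 then p.2 + c else p.2)
  | p <- zip s t].
Proof. by elim: s t => [|x s IH] [|y t] //= [] /IH ->. Qed.

Lemma mem_zip (S T : eqType) (s : seq S) (t : seq T) p :
  p \in zip s t -> (p.1 \in s) && (p.2 \in t).
Proof.
elim: s t => [|x s IH] [|y t] //=.
by rewrite !inE => /orP[/eqP ->|/IH /andP[-> ->]]; rewrite ?eqxx ?orbT.
Qed.

(** Comparison with the pair (c, c') shows that a letter of A or B is shifted exactly when its label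
    is. The inserted labels fill only values from c' to c' + t - 1, a gap that no other label
    enters. *)
Lemma st_rel_insert A A' c c' B B' v v' s t :
  size A = size A' -> size B = size B' -> size v = size v' ->
  pairwise st_rel (zip (A ++ c :: B) (A' ++ c' :: B')) ->
  c' \notin A' -> c' \notin B' -> 0 < c -> 0 < c' ->
  (forall a, a \in v -> 0 < a <= s) -> (forall a, a \in v' -> 0 < a <= t) ->
  pairwise st_rel (zip v v') ->
  pairwise st_rel (zip (insert_word s (A ++ c :: B) (size A).+1 v)
                       (insert_word t (A' ++ c' :: B') (size A').+1 v')).
Proof.
move=> sA sB sv; rewrite zip_cat //= pairwise_cat allrel_consr /=.
case/and4P => /andP[/allP rAc /allrelP rAB] rA /allP rcB rB cA cB c0 c'0 hv hv' rv.
rewrite !insert_word_cat !zip_cat ?size_map // !zip_inc //.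
(* The labels beside c' differ from it, so weak and strict comparisons with c' agree. *)
have hA p : p \in zip A A' -> p.2 != c'.
  by case/mem_zip/andP => _; apply: contraTneq => ->.
have hB p : p \in zip B B' -> p.2 != c'.
  by case/mem_zip/andP => _; apply: contraTneq => ->.
have hV p : p \in zip v v' -> (0 < p.1 <= s) && (0 < p.2 <= t).
  by case/mem_zip/andP => /hv -> /hv' ->.
rewrite !pairwise_cat !allrel_catr; apply/and3P; split.
- rewrite !allrel_mapl !allrel_mapr; apply/andP; split; apply/allrelP => p q pA.
    by move=> /hV; have := rAc _ pA; have := hA _ pA; rewrite /st_rel /=;
    do !case: ifP => ?; lia.
  move=> qB; have := rAB _ _ pA qB; have := rcB _ qB; have := hB _ qB.
  by have := rAc _ pA; have := hA _ pA; rewrite /st_rel /=;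
    do !case: ifP => ?; lia.
- rewrite pairwise_map; apply: (sub_in_pairwise _ (allss (zip A A'))) rA.
  move=> p q pA qA; have := rAc _ pA; have := rAc _ qA.
  by have := hA _ pA; have := hA _ qA; rewrite /st_rel /=;
    do !case: ifP => ?; lia.
apply/and3P; split.
- rewrite !allrel_mapl !allrel_mapr; apply/allrelP => p q /hV hp qB.
  by have := rcB _ qB; have := hB _ qB; move: hp; rewrite /st_rel /=;
    do !case: ifP => ?; lia.
- rewrite pairwise_map; apply: (sub_in_pairwise _ (allss (zip v v'))) rv.
  by move=> p q /hV hp /hV hq; move: hp hq; rewrite /st_rel /=;
    do !case: ifP => ?; lia.
- rewrite pairwise_map; apply: (sub_in_pairwise _ (allss (zip B B'))) rB.
  move=> p q pB qB; have := rcB _ pB; have := hB _ pB.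
  by have := rcB _ qB; have := hB _ qB; rewrite /st_rel /=;
    do !case: ifP => ?; lia.
Qed.

Lemma split_position (w : seq nat) i : i < size w ->
  exists A c B, w = A ++ c :: B /\ size A = i.
Proof.
move=> hi; exists (take i w), (nth 0 w i), (drop i.+1 w).
by rewrite -drop_nth // cat_take_drop size_takel // ltnW.
Qed.

Lemma st_word_insert u v i : is_packed u -> is_packed v -> i < size u ->
  0 < size v ->
  st_word (insert_word (maxletter v) u i.+1 v) =
  insert_word (size v) (st_word u) i.+1 (st_word v).
Proof.
move=> /has_letters_maxletter hu /has_letters_maxletter hv iu v0.
have su := size_st_word u; have sv := size_st_word v.
have hu' := has_letters_perm (st_word_perm u).
have hv' := has_letters_perm (st_word_perm v).
have hi' : i < size (st_word u) by rewrite su.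
apply: (@st_rel_inj (insert_word (maxletter v) u i.+1 v)).
- exact: st_word_perm.
(* The inserted labels use the letters 1 to size u + (size v - 1), which is also their number, so
   they form a permutation. *)
- rewrite size_insert_word //; apply: perm_eq_has_letters.
    by rewrite size_insert_word // su sv.
  have -> : (size u + size v).-1 = size u + (size v).-1 by lia.
  by apply: has_letters_insert; rewrite ?sv.
- exact: st_word_rel.
have ust : uniq (st_word u) by rewrite (perm_uniq (st_word_perm u)) iota_uniq.
have := st_word_rel u; have rv := st_word_rel v.
move: ust hu hu' su (hi') (iu).
have [A' [c' [B' [-> sA']]]] := split_position hi'.
have [A [c [B [-> sA]]]] := split_position iu.
rewrite !size_cat /= => ust hu hu' su _ _ ru.
rewrite -{1}sA -sA'; apply: st_rel_insert => //.
- by rewrite sA sA'.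
- by lia.
- by move: ust; rewrite cat_uniq /= => /and3P[_ /norP[]].
- by move: ust; rewrite cat_uniq /= => /and4P[].
- by have := hu c; rewrite mem_cat mem_head orbT; lia.
- by have := hu' c'; rewrite mem_cat mem_head orbT; lia.
- by move=> a; rewrite hv.
- by move=> a; rewrite hv'.
Qed.

(** * The label of a given position *)

Lemma count_zip (S T : eqType) (a : pred S) (b : pred T) s t : size s = size t ->
  {in zip s t, forall p, a p.1 = b p.2} -> count a s = count b t.
Proof.
move=> st ab; rewrite -(@unzip1_zip _ _ s t) ?st // -{2}(@unzip2_zip _ _ s t) ?st //.
by rewrite !count_map; apply: eq_in_count => p /ab.
Qed.

(** The smaller labels are those of the letters at most c on the left and of the letters below c on
    the right. *)
Lemma letter_st_word A c B :
  letter (st_word (A ++ c :: B)) (size A).+1 =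
  (count (geq c) A + count (gtn c) B).+1.
Proof.
set u := A ++ c :: B; have su := size_st_word u.
have hA : size A < size (st_word u) by rewrite su size_cat /=; lia.
have ru := st_word_rel u; have pu := st_word_perm u.
have uu : uniq (st_word u) by rewrite (perm_uniq pu) iota_uniq.
move: ru pu uu su; have [A' [c' [B' [-> sA]]]] := split_position hA.
move=> ru pu uu; rewrite /u !size_cat /= => su.
rewrite /letter /= nth_cat sA ltnn subnn /=.
have c'in : c' \in A' ++ c' :: B' by rewrite mem_cat mem_head orbT.
have sB : size B = size B' by lia.
rewrite (count_ltn_perm pu c'in) count_cat /= ltnn add0n.
move: ru uu; rewrite /u zip_cat ?sA //= pairwise_cat allrel_consr /=.
case/and4P => /andP[/allP rAc _] _ /allP rcB _; rewrite cat_uniq /=.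
case/and4P => _ _ c'B _; congr (_ + _).+1; apply: esym; apply: count_zip => //.
  by move=> p /rAc /eqP /= ->.
(* On the right, [st_rel] describes c' < y; since y differs from c', negating it describes y <
   c'. *)
case=> [x y] pB /=; have /= := rcB _ pB; rewrite /st_rel /=.
have /andP[_ pB'] := mem_zip pB.
have : y != c' by apply: contraNneq c'B => <-.
lia.
Qed.

(** * Sorting a composition *)

(* The parts of the sorting of A ++ c :: B before and after the letter c
   displayed here: the other occurrences of c lie before it if they are in A,
   and after it if they are in B. *)
Definition low c A B := sort leq (filter (geq c) A ++ filter (gtn c) B).
Definition high c A B := sort leq (filter (ltn c) A ++ filter (leq c) B).

Lemma size_low c A B : size (low c A B) = count (geq c) A + count (gtn c) B.
Proof. by rewrite size_sort size_cat !size_filter. Qed.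

Lemma low_le c A B a : a \in low c A B -> a <= c.
Proof. by rewrite mem_sort mem_cat !mem_filter /=; lia. Qed.

Lemma high_ge c A B a : a \in high c A B -> c <= a.
Proof. by rewrite mem_sort mem_cat !mem_filter /=; lia. Qed.

Lemma pairwise_leq_sort s : pairwise leq (sort leq s).
Proof. by rewrite -(sorted_pairwise leq_trans); apply: sort_sorted leq_total _. Qed.

Lemma sort_leqP s t : pairwise leq t -> perm_eq s t -> sort leq s = t.
Proof.
move=> lt st; apply: (pairwise_eq anti_leq) => //; first exact: pairwise_leq_sort.
by rewrite perm_sort.
Qed.

Lemma perm_inc a b s :
  perm_eq (inc a b s) (filter (geq b) s ++ map (addn a) (filter (ltn b) s)).
Proof.
apply/permP => p; rewrite count_cat; elim: s => //= x s ->.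
by case: ltnP => _ /=; [rewrite (addnC x) addnCA | rewrite addnA].
Qed.

Lemma sort_cat_low_high A c B :
  sort leq (A ++ c :: B) = low c A B ++ c :: high c A B.
Proof.
apply: sort_leqP.
  rewrite pairwise_cat /= !pairwise_leq_sort allrel_consr andbT /=.
  apply/andP; split; last by apply/allP => a /high_ge.
  apply/andP; split; first by apply/allP => a /low_le.
  by apply/allrelP => a b /low_le ac /high_ge; apply: leq_trans.
apply/permP => p; rewrite !count_cat /= !count_sort !count_cat.
have e (q : pred nat) s :
    count p s = count p (filter q s) + count p (filter (predC q) s).
  by rewrite -count_cat; apply/permP; rewrite perm_sym; apply/permPl/perm_filterC.
rewrite (e (geq c) A) (e (gtn c) B).
have -> : filter (predC (geq c)) A = filter (ltn c) A.
  by apply: eq_filter => a /=; rewrite -ltnNge.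
have -> : filter (predC (gtn c)) B = filter (leq c) B.
  by apply: eq_filter => a /=; rewrite -leqNgt.
by rewrite addnACA [RHS]addnACA; congr (_ + _); rewrite addnCA.
Qed.

(** Of the letters of A and B, [inc] fixes those collected in [low] and adds s - 1 to those in
    [high]; the translate of v has its letters between c and c + s - 1, hence fits between the
    two. *)
Lemma sort_insert A c B v s : 0 < c -> (forall a, a \in v -> 0 < a <= s) ->
  sort leq (insert_word s (A ++ c :: B) (size A).+1 v) =
  low c A B ++ map (addn c.-1) (sort leq v) ++ map (addn s.-1) (high c A B).
Proof.
move=> c0 hv; rewrite insert_word_cat; apply: sort_leqP.
  rewrite !pairwise_cat allrel_catr !pairwise_map !pairwise_leq_sort /=.
  rewrite !allrel_mapr !allrel_mapl; apply/and4P; split.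
  - apply/andP; split; apply/allrelP => a b /low_le ac.
      by rewrite mem_sort => /hv /=; lia.
    by move=> /high_ge /=; lia.
  - apply/allrelP => a b; rewrite mem_sort => /hv /= + /high_ge; lia.
  - apply: sub_pairwise (pairwise_leq_sort v) => a b /=; lia.
  - apply: sub_pairwise (pairwise_leq_sort _) => a b /=; lia.
have -> : inc c.-1 0 v = map (addn c.-1) v.
  by apply/eq_in_map => a /hv /andP[-> _]; rewrite addnC.
apply/permP => p; rewrite !count_cat !(permP (perm_inc _ _ _)) !count_cat.
rewrite !count_map !count_sort !count_cat.
(* As c is positive, the threshold c - 1 used on the right of c moves the copies of c there into
   [high]. *)
have -> : filter (geq c.-1) B = filter (gtn c) B.
  by apply: eq_filter => a /=; lia.
have -> : filter (ltn c.-1) B = filter (leq c) B.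
  by apply: eq_filter => a /=; lia.
lia.
Qed.

(** * Ascent words of sorted compositions *)

Lemma size_to_i2_word w : size (to_i2_word w) = (size w).-1.
Proof. by rewrite size_map size_iota. Qed.

Lemma to_i2_word_cat P c Q :
  to_i2_word (P ++ c :: Q) = to_i2_word (rcons P c) ++ to_i2_word (c :: Q).
Proof.
elim: P => // a [|b P] IH; first by rewrite /= !to_i2_word_cons.
rewrite [LHS](to_i2_word_cons a b (P ++ c :: Q)) !rcons_cons.
by rewrite (to_i2_word_cons a b (rcons P c)) cat_cons -IH.
Qed.

Lemma to_i2_word_map_addn k w : to_i2_word (map (addn k) w) = to_i2_word w.
Proof.
elim: w => // a [|b w] // IH; rewrite !map_cons !to_i2_word_cons ltn_add2l.
by rewrite -IH.
Qed.

(** Being packed and nonempty, v contains 1 and its maximum s, so its sorted translate by c - 1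
    starts at c and ends at c + s - 1: the two letters at which the ascent word of the composition
    is cut. *)
Lemma sort_packed v : is_packed v -> 0 < size v ->
  exists t, sort leq v = 1 :: t /\ last 1 t = maxletter v.
Proof.
move=> /has_letters_maxletter hv v0.
have := pairwise_leq_sort v; have := mem_sort leq v; have := size_sort leq v.
case: (sort leq v) => [|a t]; first by move=> /=; lia.
move=> _ mt; rewrite -(path_pairwise leq_trans) => pt.
have hmin b : b \in v -> a <= b.
  rewrite -mt inE => /orP[/eqP -> //|]; move: b; apply/allP.
  exact: order_path_min leq_trans pt.
have hmax b : b \in v -> b <= last a t.
  rewrite -mt => bt; move: pt bt; rewrite (path_pairwise leq_trans) lastI.
  rewrite pairwise_rcons mem_rcons inE => /andP[/allP h _] /orP[/eqP -> //|].
  exact: h.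
have := hv a; rewrite -mt mem_head => /esym ha.
have := hmin 1; rewrite hv => /(_ _) h1.
have a1 : a = 1 by lia.
exists t; subst a; split=> //.
have := hv (last 1 t); rewrite -mt mem_last => /esym hl.
by have := hmax (maxletter v); rewrite hv; lia.
Qed.

Lemma to_i2_word_insert u v i (r := (letter (st_word u) i.+1).-1) :
  is_packed u -> is_packed v -> i < size u -> 0 < size v ->
  to_i2_word (sort leq (insert_word (maxletter v) u i.+1 v)) =
  take r (to_i2_word (sort leq u)) ++ to_i2_word (sort leq v)
    ++ drop r (to_i2_word (sort leq u)).
Proof.
move=> /has_letters_maxletter hu pv iu v0.
have hv := has_letters_maxletter pv; have [t [vt tmax]] := sort_packed pv v0.
move: hu @r; have [A [c [B [-> <-]]]] := split_position iu => hu.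
have c0 : 0 < c by have := hu c; rewrite mem_cat mem_head orbT; lia.
(* The cut [r] becomes the size of [low], which is also the length of the ascent word of [low]
   followed by c. *)
rewrite letter_st_word -size_low /=.
rewrite sort_insert //; last by move=> a; rewrite hv.
rewrite sort_cat_low_high; set P := low c A B; set Q := high c A B.
rewrite to_i2_word_cat take_size_cat ?drop_size_cat ?size_to_i2_word ?size_rcons //.
have -> : map (addn c.-1) (sort leq v) = c :: map (addn c.-1) t.
  by rewrite vt /= addn1 prednK.
rewrite cat_cons to_i2_word_cat; congr (_ ++ _).
(* This last letter is c translated by s - 1, so with the translate of Q it forms a translate of c
   :: Q and has the same ascents. *)
have l : last c (map (addn c.-1) t) = (maxletter v).-1 + c.
  rewrite -{1}(prednK c0) -addn1 last_map tmax.
  by have := hv 1; rewrite -(mem_sort leq) vt mem_head; lia.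
rewrite -cat_cons lastI cat_rcons to_i2_word_cat -lastI l.
rewrite -map_cons !to_i2_word_map_addn vt; congr (_ ++ _).
by rewrite -[RHS](to_i2_word_map_addn c.-1) /= addn1 prednK.
Qed.

(** * Back to packed words and their linear spans *)

Lemma chi_pas_word n m (u : packed n.+1) (v : packed m.+1) (i : 'I_n.+1) :
  chi (pas_word u i v) =
  of_i2 (i2_word (to_i2 (chi u)) (rec i u) (to_i2 (chi v))).
Proof.
apply: (can_inj (@to_i2K _)); rewrite of_i2K; apply/val_inj/val_inj => /=.
have hi : i < size u by rewrite size_tuple.
rewrite /chi_word to_i2_word_insert ?size_tuple ?packedP //.
have -> : (letter (st_word u) i.+1).-1 = rec i u by rewrite -recE.
rewrite /subword subn1 /= drop0; congr (_ ++ (_ ++ _)).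
by rewrite take_oversize // size_drop size_to_i2_word size_sort size_tuple subSS.
Qed.

Lemma st_pas_word n m (u : packed n.+1) (v : packed m.+1) (i : 'I_n.+1) :
  st (pas_word u i v) = block i (st u) (st v).
Proof.
apply/val_inj/val_inj/val_inj => /=.
by rewrite st_word_insert ?size_tuple ?packedP.
Qed.

Lemma act_chi_st_packed n (w : packed n) : act (chi w) (st w) = w.
Proof. by apply/val_inj/val_inj; exact: act_chi_st. Qed.

Theorem theorem2p2 (K : fieldType) (n m : nat)
    (u : packed n.+1) (v : packed m.+1) (i : 'I_n.+1) :
  [/\ pas_comp i (E K u) (E K v) =
        pas_act
          (pas_of_i2
             (i2_comp (rec i u) (E2 K (to_i2 (chi u))) (E2 K (to_i2 (chi v)))))
          (block i (st u) (st v)),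
      pas_chi (pas_comp i (E K u) (E K v)) =
        pas_of_i2
          (i2_comp (rec i u) (E2 K (to_i2 (chi u))) (E2 K (to_i2 (chi v))))
    & pas_st (pas_comp i (E K u) (E K v)) = E K (block i (st u) (st v))].
Proof.
rewrite /pas_comp /i2_comp /pas_act /pas_chi /pas_st /pas_of_i2 !lin_extU.
(* On basis elements, with w the composed word, the right-hand sides become chi(w) . st(w), chi(w)
   and st(w). *)
by rewrite -chi_pas_word -st_pas_word act_chi_st_packed.
Qed.
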